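(* There exists a consistent atomic RCC8 network over $\{\mathbf{PO},\mathbf{TPP},\mathbf{TPP}^{-1}\}$ which has no convex solution in $\mathbb{R}$.
   Context: A region in $\mathbb{R}^n$ ($n\geq 1$) is a nonempty regular closed subset $X$, i.e. $X=\mathrm{cl}(\mathrm{int}(X))$; write $i(X)$ for the interior. The eight RCC8 base relations between regions $a,b$ (jointly exhaustive and pairwise disjoint; $\subset$ denotes proper inclusion) are: $a\,\mathbf{EQ}\,b$: $a=b$; $a\,\mathbf{DC}\,b$: $a\cap b=\emptyset$; $a\,\mathbf{EC}\,b$: $a\cap b\neq\emptyset$ and $i(a)\cap i(b)=\emptyset$; $a\,\mathbf{PO}\,b$: $i(a)\cap i(b)\neq\emptyset$, $a\not\subseteq b$, $b\not\subseteq a$; $a\,\mathbf{TPP}\,b$: $a\subset b$ and $a\not\subset i(b)$; $a\,\mathbf{NTPP}\,b$: $a\subset i(b)$; and the converses $\mathbf{TPP}^{-1}$, $\mathbf{NTPP}^{-1}$ of the last two. Let $V$ be a finite set of variables. An RCC8 constraint is an expression $u\,R\,v$ with $u,v\in V$ and $R$ a nonempty set of base relations; an RCC8 network is a set of such constraints. It is atomic if for every pair of distinct variables $u,v$ it contains a constraint $u\,R\,v$ or $v\,R\,u$ with $R$ a singleton. It is a network over a set $\mathcal{R}$ of base relations if every constraint $u\,R\,v$ in it has $R\subseteq\mathcal{R}$. An $n$-dimensional solution (solution in $\mathbb{R}^n$) of a network is a map $\mathcal{S}$ from $V$ to regions of $\mathbb{R}^n$ such that for each constraint $u\,R\,v$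 the base relation holding between $\mathcal{S}(u)$ and $\mathcal{S}(v)$ belongs to $R$. A network is consistent if it has a solution in $\mathbb{R}^n$ for some $n\geq 1$ (the regions need not be convex or connected). A solution is convex if every $\mathcal{S}(v)$ is a convex set. *)

(* Defs.v *)
From HB Require Import structures.
From mathcomp Require Import all_boot all_order all_algebra.
From mathcomp Require Import boolp classical_sets reals topology normedtype convex.

Set Implicit Arguments.
Unset Strict Implicit.
Unset Printing Implicit Defensive.

Import Order.TTheory GRing.Theory Num.Theory numFieldNormedType.Exports.
Local Open Scope classical_set_scope.

Definition region (T : topologicalType) (X : set T) : Prop :=
  X !=set0 /\ regclosed X.

(* TPPi and NTPPi are the converses of TPP and NTPP. *)
Inductive rcc8 := EQ | DC | EC | PO | TPP | NTPP | TPPi | NTPPi.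

(* [`<`] is proper inclusion. *)
Definition tpp (T : topologicalType) (a b : set T) : Prop :=
  a `<` b /\ ~ (a `<` interior b).

Definition ntpp (T : topologicalType) (a b : set T) : Prop :=
  a `<` interior b.

Definition rcc8_holds (T : topologicalType) (r : rcc8) (a b : set T) : Prop :=
  match r with
  | EQ => a = b
  | DC => a `&` b = set0
  | EC => a `&` b !=set0 /\ interior a `&` interior b = set0
  | PO => [/\ interior a `&` interior b !=set0, ~ (a `<=` b) & ~ (b `<=` a)]
  | TPP => tpp a b
  | NTPP => ntpp a b
  | TPPi => tpp b a
  | NTPPi => ntpp b a
  end.

Record rcc8_constraint (V : finType) := RCC8Constraint {
  clhs : V;
  crel : set rcc8;
  crhs : V;
  crel_nonempty : crel !=set0
}.

Definition rcc8_network (V : finType) := set (rcc8_constraint V).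

Definition atomic (V : finType) (N : rcc8_network V) : Prop :=
  forall u v : V, u <> v ->
    exists2 c, N c &
      (clhs c = u /\ crhs c = v \/ clhs c = v /\ crhs c = u) /\
      exists r : rcc8, crel c = [set r].

Definition network_over (V : finType) (B : set rcc8) (N : rcc8_network V) :
    Prop :=
  forall c, N c -> crel c `<=` B.

(* R^n is 'rV[R]_n with its product topology. *)
Definition solution (R : realType) (V : finType) (N : rcc8_network V) (n : nat)
    (S : V -> set 'rV[R]_n) : Prop :=
  (forall v, region (S v)) /\
  (forall c, N c ->
     exists2 r, crel c r & rcc8_holds r (S (clhs c)) (S (crhs c))).

Definition consistent (R : realType) (V : finType) (N : rcc8_network V) :
    Prop :=
  exists2 n : nat, (1 <= n)%N & exists S : V -> set 'rV[R]_n, solution N S.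

Definition convex_solution (R : realType) (V : finType) (N : rcc8_network V)
    (n : nat) (S : V -> set 'rV[R]_n) : Prop :=
  solution N S /\ forall v, convex_set (S v).

(* Main.v *)
Require Import Defs.
From mathcomp Require Import all_boot all_order all_algebra.
From mathcomp Require Import boolp classical_sets reals topology normedtype convex.
From mathcomp Require Import interval_inference.
From mathcomp Require Import ring lra.

(** In a convex solution on the line, a tangential proper part of an interval
    [b] contains a boundary point of [b], hence an endpoint of [b].  Among three
    tangential proper parts two contain the same endpoint, so these two are
    nested and cannot partially overlap.  On the other hand the orthant
    [0 <= x] of R^3 has the three pairwise overlapping tangential proper parts
    [e_i <= x], where [e_i] are the unit vectors. *)

Set Implicit Arguments.
Unset Strict Implicit.
Unset Printing Implicit Defensive.

Import Order.TTheory GRing.Theory Num.Theory numFieldNormedType.Exports.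
Local Open Scope classical_set_scope.
Local Open Scope ring_scope.

(** Small diagonal shifts stay in a neighbourhood. A downward shift will test membership in the
    interior of an orthant, an upward one membership in the closure. *)
Lemma nbhs_rV_translate (R : realType) (n : nat) (x : 'rV[R]_n)
    (B : set 'rV[R]_n) :
  nbhs x B -> exists2 e : R, 0 < e & forall d, `|d| < e -> B (x + const_mx d).
Proof.
move=> /nbhs_ballP[e /= e0 xB]; exists e => // d de.
apply: xB; split=> // i j; rewrite !mxE -ball_normE /=.
by rewrite opprD addrA subrr sub0r normrN.
Qed.

Definition orthant (R : realType) (n : nat) (v : 'rV[R]_n) : set 'rV[R]_n :=
  [set x | forall i, v 0 i <= x 0 i].

Definition open_orthant (R : realType) (n : nat) (v : 'rV[R]_n) :
    set 'rV[R]_n :=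
  [set x | forall i, v 0 i < x 0 i].

Lemma open_open_orthant (R : realType) (n : nat) (v : 'rV[R]_n) :
  open (open_orthant v).
Proof.
rewrite openE => x vx.
apply: (@filter_forall _ _ (fun i (y : 'rV[R]_n) => v 0 i < y 0 i)
  (nbhs x) _) => i.
exact: (coord_continuous (lt_nbhsr (vx i))).
Qed.

Lemma interior_orthant (R : realType) (n : nat) (v : 'rV[R]_n) :
  interior (orthant v) = open_orthant v.
Proof.
apply/seteqP; split=> [x /nbhs_rV_translate[e e0 xe] i|x vx].
  have /xe/(_ i) : `|- (e / 2)| < e by rewrite normrN gtr0_norm; lra.
  by rewrite !mxE; lra.
have := @open_open_orthant R n v; rewrite openE => /(_ x vx).
by apply: filterS => y vy i; exact: ltW.
Qed.

Lemma closure_open_orthant (R : realType) (n : nat) (v : 'rV[R]_n) :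
  closure (open_orthant v) = orthant v.
Proof.
apply/seteqP; split=> x.
  move=> vx i; rewrite leNgt; apply/negP => xv.
  have [y [vy yv]] := vx _ (coord_continuous (lt_nbhsl xv)).
  by have := vy i; rewrite ltNge (ltW yv).
move=> vx B /nbhs_rV_translate[e e0 xe]; exists (x + const_mx (e / 2)).
split; last by apply: xe; rewrite gtr0_norm; lra.
by move=> i; have := vx i; rewrite !mxE; lra.
Qed.

Lemma region_orthant (R : realType) (n : nat) (v : 'rV[R]_n) :
  region (orthant v).
Proof.
split; first by exists v => i; exact: lexx.
by rewrite -closure_open_orthant; apply: closure_open_regclosed;
  exact: open_open_orthant.
Qed.

(** An orthant contains its own corner, so the corners [v] and [w] refute the two inclusions, while
    the interiors always meet above the coordinatewise maximum. *)
Lemma PO_orthant (R : realType) (n : nat) (v w : 'rV[R]_n) (i j : 'I_n) :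
  v 0 i < w 0 i -> w 0 j < v 0 j -> rcc8_holds PO (orthant v) (orthant w).
Proof.
move=> vw wv; split.
- rewrite !interior_orthant.
  exists (\row_k (Num.max (v 0 k) (w 0 k) + 1)).
  by split=> k; rewrite mxE ltr_pwDr// le_max lexx ?orbT.
- by move=> /(_ v (fun=> lexx _))/(_ i); rewrite leNgt vw.
- by move=> /(_ w (fun=> lexx _))/(_ j); rewrite leNgt wv.
Qed.

(** Tangency is witnessed by the corner [w]: it shares coordinate [j] with [v], hence lies outside
    the interior of [orthant v]. *)
Lemma TPP_orthant (R : realType) (n : nat) (v w : 'rV[R]_n) (i j : 'I_n) :
  (forall k, v 0 k <= w 0 k) -> v 0 i < w 0 i -> w 0 j = v 0 j ->
  rcc8_holds TPP (orthant w) (orthant v).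
Proof.
move=> vw vwi wvj; split.
  split; first by move=> x wx k; exact: le_trans (vw k) (wx k).
  by move=> /(_ v (fun=> lexx _))/(_ i); rewrite leNgt vwi.
move=> [+ _] => /(_ w (fun=> lexx _)).
by rewrite interior_orthant => /(_ j); rewrite wvj ltxx.
Qed.

Lemma convex_rV1_between (R : realType) (A : set 'rV[R]_1) :
  convex_set A -> forall x y z : 'rV[R]_1, A x -> A y ->
  x 0 0 <= z 0 0 <= y 0 0 -> A z.
Proof.
move=> cA x y z Ax Ay /andP[xz zy].
have [xy|yx] := ltP (x 0 0) (y 0 0); last first.
  suff -> : z = x by [].
  by apply/rowP => i; rewrite ord1; lra.
have d0 : 0 < y 0 0 - x 0 0 by rewrite subr_gt0.
(* [t] is the weight of [x] in the combination [z = t x + (1 - t) y]. *)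
pose t := (y 0 0 - z 0 0) / (y 0 0 - x 0 0).
have t0 : 0 <= t by rewrite divr_ge0//; lra.
have t1 : t <= 1 by rewrite ler_pdivrMr//; lra.
have := cA x y (Itv01 t0 t1) (mem_set Ax) (mem_set Ay).
move=> /set_mem; congr (A _); apply/rowP => i; rewrite ord1 !mxE/=.
rewrite /unstable.onem /t; field; lra.
Qed.

(** Endpoints are indexed by a boolean, [true] for the left one and [false] for the right one, so
    that a pigeonhole argument can count them. *)
Definition extreme_point {R : realType} (s : bool) (p : 'rV[R]_1)
    (b : set 'rV[R]_1) : Prop :=
  b p /\ forall x, b x -> if s then p 0 0 <= x 0 0 else x 0 0 <= p 0 0.

Lemma TPP_boundary_point (T : topologicalType) (a b : set T) :
  regclosed a -> regclosed b -> tpp a b ->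
  exists p, [/\ a p, b p & ~ interior b p].
Proof.
move=> ra rb [[ab nba] nab]; apply: contrapT => npb; apply: nab; split.
  move=> x ax; apply: contrapT => nbx; apply: npb.
  by exists x; split => //; exact: ab.
(* Were the interior of [b] inside [a], taking closures would put [b] inside [a], against proper
   inclusion. *)
move=> ba; apply: nba; rewrite -rb.
have -> : a = closure a by apply/closure_id; rewrite -ra; exact: closed_closure.
exact: closure_subset.
Qed.

(** A boundary point of a convex [b] cannot have points of [b] strictly on both sides: everything
    between them lies in [b] and forms a neighbourhood of it. *)
Lemma TPP_extreme_point (R : realType) (a b : set 'rV[R]_1) :
  regclosed a -> regclosed b -> convex_set b -> tpp a b ->
  exists (s : bool) p, a p /\ extreme_point s p b.
Proof.
move=> ra rb cb /(TPP_boundary_point ra rb)[p [ap bp nbp]].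
have [pb|/existsNP[y /not_implyP[by_ /negP]]] :=
  pselect (forall x, b x -> p 0 0 <= x 0 0).
  by exists true, p.
rewrite -ltNge => yp.
exists false, p; split => //; split => // z bz; rewrite leNgt; apply/negP => pz.
apply: nbp.
near=> x; apply: (convex_rV1_between cb by_ bz); apply/andP; split; apply: ltW.
  by near: x; exact: (coord_continuous (lt_nbhsr yp)).
by near: x; exact: (coord_continuous (lt_nbhsl pz)).
Unshelve. all: by end_near. Qed.

Lemma extreme_point_inj (R : realType) (s : bool) (b : set 'rV[R]_1)
    (p q : 'rV[R]_1) :
  extreme_point s p b -> extreme_point s q b -> p = q.
Proof.
move=> [bp pb] [bq qb]; apply/rowP => i; rewrite ord1.
by move: (pb _ bq) (qb _ bp); case: s {pb qb} => *; apply/le_anti/andP.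
Qed.

(** Given [x] in [a] only and [y] in [c] only, the one closer to the common endpoint [p] lies
    between [p] and the other, hence in both sets. *)
Lemma convex_extreme_nested (R : realType) (s : bool) (p : 'rV[R]_1)
    (a c b : set 'rV[R]_1) :
  convex_set a -> convex_set c -> a `<=` b -> c `<=` b ->
  a p -> c p -> extreme_point s p b -> a `<=` c \/ c `<=` a.
Proof.
move=> /convex_rV1_between ca /convex_rV1_between cc ab cb ap cp [_ pb].
have [//|/existsNP[x /not_implyP[ax ncx]]] := pselect (a `<=` c); first by left.
right => y cy; apply: contrapT => nay.
move: (pb _ (ab _ ax)) (pb _ (cb _ cy)).
case: s {pb} => px py; have [xy|/ltW yx] := leP (x 0 0) (y 0 0).
- by apply: ncx; apply: (cc p y) => //; rewrite px.
- by apply: nay; apply: (ca p x) => //; rewrite py.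
- by apply: nay; apply: (ca x p) => //; rewrite xy.
- by apply: ncx; apply: (cc y p) => //; rewrite yx.
Qed.

(* [Some i] are the small regions and [None] is the region containing them. *)
Definition three_in_one_spec (u v : option 'I_3) : option rcc8 :=
  match u, v with
  | Some i, Some j => if i == j then None else Some PO
  | Some _, None => Some TPP
  | None, _ => None
  end.

Definition three_in_one : rcc8_network (option 'I_3) :=
  [set c | exists2 r, crel c = [set r] &
           three_in_one_spec (clhs c) (crhs c) = Some r].

(** Replaces constraint records by pairs of variables, both to verify a solution and to exploit
    one. *)
Lemma three_in_one_holds (T : topologicalType) (S : option 'I_3 -> set T) :
  (forall c, three_in_one c ->
     exists2 r, crel c r & rcc8_holds r (S (clhs c)) (S (crhs c))) <->
  (forall u v r, three_in_one_spec u v = Some r -> rcc8_holds r (S u) (S v)).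
Proof.
split=> [NS u v r uvr|NS c [r cr uvr]]; last first.
  by exists r; [rewrite cr|exact: NS].
have r0 : [set r] !=set0 by exists r.
by have [|_ /= ->//] := NS (RCC8Constraint u v r0); exists r.
Qed.

Lemma three_in_one_over : network_over [set PO; TPP; TPPi] three_in_one.
Proof.
move=> c [r -> uvr] _ ->; move: uvr.
case: (clhs c) => [i|//]; case: (crhs c) => [j|] /=.
  by case: eqP => // _ [<-]; left; left.
by move=> [<-]; left; right.
Qed.

Lemma three_in_one_atomic : atomic three_in_one.
Proof.
suff uv u v r : three_in_one_spec u v = Some r ->
    exists2 c, three_in_one c &
      (clhs c = u /\ crhs c = v) /\ exists r, crel c = [set r].
  move=> u v neq_uv.
  have : exists r, three_in_one_spec u v = Some r \/
                   three_in_one_spec v u = Some r.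
    case: u v neq_uv => [i|] [j|] //= ij; last 2 first.
    - by exists TPP; left.
    - by exists TPP; right.
    by exists PO; left; case: eqP => // e; case: ij; rewrite e.
  by move=> [r [/uv|/uv]] [c Nc [? ?]]; exists c => //; split => //;
    [left|right].
move=> uvr; have r0 : [set r] !=set0 by exists r.
by exists (RCC8Constraint u v r0); [exists r|split => //; exists r].
Qed.

Lemma three_in_one_consistent (R : realType) : consistent R three_in_one.
Proof.
pose e (v : option 'I_3) : 'rV[R]_3 := if v is Some i then delta_mx 0 i else 0.
exists 3 => //; exists (fun v => orthant (e v)); split.
  by move=> v; exact: region_orthant.
apply/(three_in_one_holds (fun v => orthant (e v))).
move=> [i|//] [j|] r /=; last first.
  (* Addition in ['I_3] is cyclic, so [i + 1] differs from [i], and there the unit vector vanishes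
     like the origin. *)
  move=> [<-]; apply: (@TPP_orthant _ _ 0 _ i (i + 1)).
  - by move=> k; rewrite !mxE ler0n.
  - by rewrite !mxE !eqxx ltr01.
  - by rewrite !mxE eqxx -(subr_eq0 _ i) addrAC subrr add0r oner_eq0.
case: eqVneq => // ij [<-]; apply: (@PO_orthant _ _ _ _ j i).
- by rewrite !mxE !eqxx eq_sym (negbTE ij) ltr01.
- by rewrite !mxE !eqxx (negbTE ij) ltr01.
Qed.

Lemma three_in_one_no_convex_line (R : realType) :
  ~ exists S : option 'I_3 -> set 'rV[R]_1, convex_solution three_in_one S.
Proof.
move=> [S [[rS /three_in_one_holds NS] cS]].
have tppS i : tpp (S (Some i)) (S None) by exact: (NS (Some i) None TPP).
have subS i : S (Some i) `<=` S None by have [[]] := tppS i.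
have /choice[s sP] : forall i, exists s p,
    S (Some i) p /\ extreme_point s p (S None).
  move=> i; apply: TPP_extreme_point (tppS i) => //.
  - by have [] := rS (Some i).
  - by have [] := rS None.
(* Two small regions on the same side share an endpoint and are nested, against [PO]; but three
   indices do not inject into two sides. *)
have : injective s.
  move=> i j sij; apply/eqP; apply: contrapT => /negP/negbTE ij.
  have [_ nij nji] : rcc8_holds PO (S (Some i)) (S (Some j)).
    by apply: NS; rewrite /= ij.
  have [p [ip bp]] := sP i; have [q [jq bq]] := sP j.
  move: jq; rewrite -sij in bq; rewrite -(extreme_point_inj bp bq) => jp.
  have [|] := convex_extreme_nested (cS _) (cS _) (@subS i) (@subS j) ip jp bp;
    by [].
by move/leq_card; rewrite card_ord card_bool.
Qed.

Theorem corollary3 (R : realType) :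
  exists (V : finType) (N : rcc8_network V),
    [/\ network_over [set PO; TPP; TPPi] N,
        atomic N,
        consistent R N &
        ~ exists S : V -> set 'rV[R]_1, convex_solution N S].
Proof.
exists (option 'I_3), three_in_one; split.
- exact: three_in_one_over.
- exact: three_in_one_atomic.
- exact: three_in_one_consistent.
- exact: three_in_one_no_convex_line.
Qed.
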